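(* Let $\widehat\delta_c=c'\mathbf W\mathbf R y$ be a linear estimator, where $\mathbf W=\mathbf W(\mathbf R)$ has $p$ rows and $kn$ columns and is differentiable (as a function of the diagonal matrix $\mathbf R$) at $\mathbf R=\boldsymbol\pi$, and $c\in\mathbb R^p$. Let $\widehat\delta^T_c$ be its first-order Taylor approximation at $\mathbf R=\boldsymbol\pi$, and let $a_c$ (a constant) and $z^T_c\in\mathbb R^{kn}$ (a constant vector) be such that $\widehat\delta^T_c=a_c+n1_k'\mathbf w^{HT}\mathbf R z^T_c$. Then $$\mathrm V\big(\widehat\delta^T_c\big)={z^T_c}'\,\mathbf d\,z^T_c .$$
   Context: Setting (Neyman causal model): there are $n$ units and $k$ treatment arms. $y=(y_1'\ y_2'\cdots y_k')'\in\mathbb R^{kn}$ is the nonrandom stacked vector of potential outcomes ($y_r\in\mathbb R^n$ collects the potential outcomes under arm $r$). $R_{ri}\in\{0,1\}$ is the random indicator that unit $i$ is assigned to arm $r$, with $\sum_{r=1}^k R_{ri}=1$ for every $i$; $\mathbf R$ is the $kn\times kn$ diagonal matrix with diagonal $(R_{11},\dots,R_{1n},\dots,R_{k1},\dots,R_{kn})$; $\boldsymbol\pi=\mathrm E[\mathbf R]$, assumed invertible (all assignment probabilities positive). $\mathbf R$ is the only random object. $1_m$ is the length-$m$ vector of ones; $\mathbb 1$ is the $kn\times k$ block-diagonal matrix with $k$ diagonal blocks each equal to $1_n$; $\mathbf w^{HT}=(\mathbb 1'\mathbb 1)^{-1}\mathbb 1'\boldsymbol\pi^{-1}$. Write $\mathbf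 w=\mathbf W(\boldsymbol\pi)$. The first-order Taylor approximation of the linear estimator is $$\widehat\delta^{T}_c = c'\mathbf w\boldsymbol\pi y + c'\mathbf w(\mathbf R-\boldsymbol\pi)y + \Big(D(c'\mathbf W)(\boldsymbol\pi)[\mathbf R-\boldsymbol\pi]\Big)\boldsymbol\pi y,$$ where $D(c'\mathbf W)(\boldsymbol\pi)[\mathbf H]$ is the derivative of $\mathbf R\mapsto c'\mathbf W(\mathbf R)$ at $\boldsymbol\pi$ in the direction of the diagonal matrix $\mathbf H$. This is an affine function of the diagonal of $\mathbf R$ and can always be written as $a_c+n1_k'\mathbf w^{HT}\mathbf R z^T_c$ with constant $a_c$ and $z^T_c$. The first-order design matrix $\mathbf d$ is the $kn\times kn$ variance-covariance matrix of the random vector $1_{kn}'\boldsymbol\pi^{-1}\mathbf R$; equivalently $\mathbf d=(\mathrm E[\mathbf R1_{kn}1_{kn}'\mathbf R]-\boldsymbol\pi1_{kn}1_{kn}'\boldsymbol\pi)/(\boldsymbol\pi1_{kn}1_{kn}'\boldsymbol\pi)$ with $/$ elementwise division. *)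

(* Defs.v *)
From HB Require Import structures.
From mathcomp Require Import all_boot all_order all_algebra.
From mathcomp Require Import all_classical all_reals all_analysis.
Set Implicit Arguments.
Unset Strict Implicit.
Unset Printing Implicit Defensive.
Import Order.TTheory GRing.Theory Num.Theory.
Import numFieldNormedType.Exports.
Local Open Scope ring_scope.

(* Vectors of length kn are stacked by arm through mxvec: unit i under arm r
   has index [mxvec_index r i]. *)

Definition assignment_mx (T : Type) (R : realType) (k n : nat)
    (D : 'I_k -> 'I_n -> T -> R) (t : T) : 'M[R]_(k * n) :=
  diag_mx (mxvec (\matrix_(r, i) D r i t)).

Definition expectation_mx (d : measure_display) (T : measurableType d)
    (R : realType) (P : probability T R) (m n : nat) (M : T -> 'M[R]_(m, n)) :
    'M[R]_(m, n) :=
  \matrix_(i, j) fine ('E_P[(fun t => M t i j)])%E.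

Definition covariance_mx (d : measure_display) (T : measurableType d)
    (R : realType) (P : probability T R) (m : nat) (X : T -> 'rV[R]_m) :
    'M[R]_m :=
  \matrix_(a, b) fine (covariance P (fun t => X t 0 a) (fun t => X t 0 b)).

(* The kn x k block-diagonal matrix with diagonal blocks 1_n: column r is the
   stacking of the k x n array whose row r is 1 and whose other rows are 0. *)
Definition arm_ones (R : realType) (k n : nat) : 'M[R]_(k * n, k) :=
  \matrix_(a, r) mxvec (\matrix_(s < k, i < n) (s == r)%:R) 0 a.

Definition w_HT (R : realType) (k n : nat) (pi : 'M[R]_(k * n)) :
    'M[R]_(k, k * n) :=
  invmx ((arm_ones R k n)^T *m arm_ones R k n) *m (arm_ones R k n)^T
    *m invmx pi.

Definition first_order_design_mx (d : measure_display) (T : measurableType d)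
    (R : realType) (P : probability T R) (m : nat)
    (pi : 'M[R]_m) (Rm : T -> 'M[R]_m) : 'M[R]_m :=
  covariance_mx P (fun t => (const_mx 1 : 'rV[R]_m) *m invmx pi *m Rm t).

Definition linear_estimator (R : realType) (p m : nat)
    (W : 'M[R]_m -> 'M[R]_(p, m)) (c : 'cV[R]_p) (y : 'cV[R]_m)
    (Rm : 'M[R]_m) : R :=
  (c^T *m W Rm *m Rm *m y) 0 0.

(* First-order expansion of [linear_estimator W c y] at [pi], with the
   derivative of the product W(R) R written out by the Leibniz rule. *)
Definition taylor_estimator (R : realType) (p m : nat)
    (W : 'M[R]_m -> 'M[R]_(p, m)) (c : 'cV[R]_p) (y : 'cV[R]_m)
    (pi Rm : 'M[R]_m) : R :=
  linear_estimator W c y pi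
  + (c^T *m W pi *m (Rm - pi) *m y) 0 0
  + ('D_(Rm - pi) (fun A : 'M[R]_m => c^T *m W A) pi *m pi *m y) 0 0.

(* W only needs to make sense on diagonal matrices, so differentiability is
   that of v |-> W (diag v), at the vector v0 of diagonal entries of [pi]. *)
Definition differentiable_on_diag (R : realType) (p m : nat)
    (W : 'M[R]_m -> 'M[R]_(p, m)) (pi : 'M[R]_m) : Prop :=
  differentiable (fun v : 'rV[R]_m => W (diag_mx v)) (\row_a pi a a).

(* Main.v *)
(* Since 1'1 = n I_k, the row vector n 1_k' w^HT equals 1_kn' pi^-1, so the
   Taylor estimator is a constant plus X z, where X = 1_kn' pi^-1 R is the row
   vector whose covariance matrix is d. Its entries are bounded, hence square
   integrable, and bilinearity of the covariance gives V(X z) = z' d z. *)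
Require Import Defs.
From HB Require Import structures.
From mathcomp Require Import all_boot all_order all_algebra.
From mathcomp Require Import all_classical all_reals all_analysis.
From mathcomp Require Import measurable_realfun.
Import Order.TTheory GRing.Theory Num.Theory.
Import numFieldNormedType.Exports.
Local Open Scope ring_scope.

(** The integral of [|f| ^ r] is at most [M ^ r] times the total mass, which is finite; [0 <= r]
    makes the power monotone. *)
Lemma bounded_Lfun (d : measure_display) (T : measurableType d) (R : realType)
    (mu : {finite_measure set T -> \bar R}) (f : T -> R) (M r : R) :
  0 <= r -> measurable_fun setT f -> (forall t, `|f t| <= M) ->
  f \in Lfun mu r%:E.
Proof.
move=> r0 mf fM; rewrite inE; apply/andP; split; rewrite inE//=.
rewrite /finite_norm unlock /Lnorm poweR_lty//.
apply: (@le_lt_trans _ _ (\int[mu]_x (M `^ r)%:E)%E).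
  apply: ge0_le_integral => //.
  - by move=> x _; rewrite lee_fin powR_ge0.
  - apply/measurable_EFinP.
    apply: (@measurableT_comp _ _ _ _ _ _ (@powR R ^~ r)) => //.
    exact: measurableT_comp.
  - move=> x _; rewrite lee_fin ge0_ler_powR// nnegrE.
    (* The sign of [M] is read off at the point [x]: 0 <= |f x| <= M. *)
    exact: le_trans (fM x).
by rewrite integral_cst// ltey_eq fin_numM// fin_num_measure.
Qed.

Section CovarianceQuadraticForm.
Variables (d : measure_display) (T : measurableType d) (R : realType).
Variable P : probability T R.

Lemma Lfun_lincomb (m : nat) (X : T -> 'rV[R]_m) (z : 'cV[R]_m) :
  (forall a, (fun t => X t 0 a) \in Lfun P 2%:E) ->
  (fun t => (X t *m z) 0 0) \in Lfun P 2%:E.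
Proof.
move=> LX.
have -> : (fun t => (X t *m z) 0 0)
        = \sum_a (z a 0 \o* (fun t => X t 0 a)) :> (T -> R).
  by apply/funext => t; rewrite mxE fct_sumE; apply: eq_bigr.
apply: rpred_sum => [|? a _]; rewrite ?lee1n//.
by apply: Lfun_scale; rewrite ?ler1n.
Qed.

Lemma covariance_lincombl (m : nat) (X : T -> 'rV[R]_m) (z : 'cV[R]_m)
    (Y : T -> R) :
  (forall a, (fun t => X t 0 a) \in Lfun P 2%:E) -> Y \in Lfun P 2%:E ->
  covariance P (fun t => (X t *m z) 0 0) Y =
  (\sum_a (z a 0)%:E * covariance P (fun t => X t 0%R a) Y)%E.
Proof.
move=> LX LY.
have Pfin : P setT \is a fin_num := fin_num_measure P _ measurableT.
have LzX a : (z a 0 \o* (fun t => X t 0 a)) \in Lfun P 2%:E.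
  by apply: Lfun_scale; rewrite ?ler1n.
have -> : (fun t => (X t *m z) 0 0)
        = \sum_a (z a 0 \o* (fun t => X t 0 a)) :> (T -> R).
  by apply/funext => t; rewrite mxE fct_sumE; apply: eq_bigr.
(* Both sums run over the same index list, so additivity in the first argument is applied one term
   at a time; each partial sum stays in L^2, and the empty sum is a constant, of covariance 0. *)
elim: (index_enum _) => [|a s IH].
  by rewrite !big_nil; exact: covariance_cst_l.
rewrite !big_cons covarianceDl// ?IH.
  by rewrite covarianceZl// ?Lfun2_mul_Lfun1// Lfun_subset12.
by apply: rpred_sum => [|? b _]; rewrite ?lee1n.
Qed.

Lemma variance_lincomb (m : nat) (X : T -> 'rV[R]_m) (z : 'cV[R]_m) :
  (forall a, (fun t => X t 0 a) \in Lfun P 2%:E) ->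
  ('V_P[(fun t => (X t *m z) 0 0)%R] =
   ((z^T *m covariance_mx P X *m z) 0 0)%:E)%E.
Proof.
move=> LX.
have Pfin : P setT \is a fin_num := fin_num_measure P _ measurableT.
(* Products of L^2 functions are in L^1, so these covariances are finite and the [fine] in
   [covariance_mx] loses nothing. *)
have covE a b : covariance P (fun t => X t 0 a) (fun t => X t 0 b)
              = (covariance_mx P X a b)%:E.
  by rewrite mxE fineK// covariance_fin_num ?Lfun2_mul_Lfun1 ?Lfun_subset12.
rewrite /variance covariance_lincombl//; last exact: Lfun_lincomb.
under eq_bigr => a _.
  (* Symmetry moves the second copy of X z to the left, where the same expansion applies; the
     indices then come out in the order of (z^T M)_a. *)
  rewrite covarianceC covariance_lincombl//.
  under eq_bigr => b _ do rewrite covE -EFinM.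
  rewrite sumEFin -EFinM; over.
rewrite sumEFin mxE; congr EFin; apply: eq_bigr => a _.
rewrite mulrC mxE; congr (_ * _).
by apply: eq_bigr => b _; rewrite [z^T _ _]mxE.
Qed.

End CovarianceQuadraticForm.

Lemma sum_mxvec_index (V : nmodType) (k n : nat) (F : 'I_(k * n) -> V) :
  \sum_a F a = \sum_(r < k) \sum_(i < n) F (mxvec_index r i).
Proof.
rewrite (reindex _ (curry_mxvec_bij _ _)) pair_bigA.
by apply: eq_bigr => -[].
Qed.

(** Distinct columns have disjoint supports, and each column holds exactly n ones. *)
Lemma tr_arm_onesM (R : realType) (k n : nat) :
  (arm_ones R k n)^T *m arm_ones R k n = n%:R%:M.
Proof.
apply/matrixP => r r'; rewrite mxE sum_mxvec_index.
under eq_bigr => s _ do under eq_bigr => i _ do rewrite !mxE !mxvecE !mxE.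
under eq_bigr => s _ do rewrite sumr_const card_ord.
rewrite (bigD1 r)//= eqxx mul1r big1 ?addr0 ?mxE.
  by case: eqVneq => _; rewrite ?mulr1n ?mulr0n// mul0rn.
by move=> s /negPf->; rewrite mul0r mul0rn.
Qed.

(** Each stacked index belongs to exactly one arm, so the columns of [arm_ones] add up to the
    all-ones vector. *)
Lemma ones_tr_arm_ones (R : realType) (k n : nat) :
  (const_mx 1 : 'rV[R]_k) *m (arm_ones R k n)^T = const_mx 1.
Proof.
apply/rowP => a; case/mxvec_indexP: a => s i; rewrite !mxE (bigD1 s)//= big1.
  by rewrite !mxE mxvecE mxE eqxx mulr1 addr0.
by move=> r /negPf rs; rewrite !mxE mxvecE mxE eq_sym rs mulr0.
Qed.

Lemma scale_ones_w_HT (R : realType) (k n : nat) (pi : 'M[R]_(k * n)) :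
  n%:R *: ((const_mx 1 : 'rV[R]_k) *m w_HT pi) = const_mx 1 *m invmx pi.
Proof.
(* Cancelling n against its inverse needs n nonzero; for n = 0 both sides are rows without
   entries. *)
case: n pi => [|n] pi.
  by apply/rowP => a; case/mxvec_indexP: a => r [].
rewrite /w_HT tr_arm_onesM invmx_scalar !mulmxA mul_mx_scalar -!scalemxAl.
by rewrite scalerA divff ?pnatr_eq0// scale1r ones_tr_arm_ones.
Qed.

Theorem theorem3p3 (R : realType) (d : measure_display) (T : measurableType d)
    (P : probability T R) (k n p : nat)
    (D : 'I_k -> 'I_n -> {RV P >-> R})
    (D01 : forall r i t, D r i t = 0 \/ D r i t = 1)
    (D_sum1 : forall i t, \sum_(r < k) D r i t = 1)
    (Rm : T -> 'M[R]_(k * n)) (pi : 'M[R]_(k * n))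
    (Rm_def : Rm = assignment_mx (fun r i => D r i : T -> R))
    (pi_def : pi = expectation_mx P Rm)
    (pi_unit : pi \in unitmx)
    (y : 'cV[R]_(k * n)) (c : 'cV[R]_p)
    (W : 'M[R]_(k * n) -> 'M[R]_(p, k * n))
    (W_diff : differentiable_on_diag W pi)
    (a : R) (z : 'cV[R]_(k * n))
    (taylor_HT : forall t, taylor_estimator W c y pi (Rm t) =
       a + n%:R * ((const_mx 1 : 'rV[R]_k) *m w_HT pi *m Rm t *m z) 0 0) :
  ('V_P[(fun t => taylor_estimator W c y pi (Rm t))]
   = ((z^T *m first_order_design_mx P pi Rm *m z) 0 0)%:E)%E.
Proof.
pose X t : 'rV[R]_(k * n) := const_mx 1 *m invmx pi *m Rm t.
have LX b : (fun t => X t 0 b) \in Lfun P 2%:E.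
  case/mxvec_indexP: b => r i.
  (* [Rm t] is diagonal, so this entry of X is a constant multiple of the single indicator [D r i],
     which is bounded by 1. *)
  have -> : (fun t => X t 0 (mxvec_index r i)) =
      (const_mx 1 *m invmx pi : 'rV_(k * n)) 0 (mxvec_index r i) \o* D r i.
    apply/funext => t.
    by rewrite /X Rm_def /assignment_mx mul_mx_diag mxE mxvecE [X in _ * X]mxE mulrC.
  apply: Lfun_scale; first by rewrite ler1n.
  apply: (@bounded_Lfun _ _ _ _ _ 1) => // t.
  by case: (D01 r i t) => ->; rewrite ?normr0 ?normr1.
(* The factor n is absorbed into [w_HT], and [a] is split off as a constant summand, which leaves
   the variance unchanged. *)
have -> : (fun t => taylor_estimator W c y pi (Rm t)) =
    ((fun t => (X t *m z) 0 0) \+ cst a)%R.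
  apply/funext => t /=; rewrite taylor_HT addrC; congr (_ + _).
  by rewrite /X -scale_ones_w_HT -!scalemxAl [RHS]mxE.
rewrite varianceD_cst_r; last exact: Lfun_lincomb.
exact: variance_lincomb.
Qed.
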